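(* Let $f\in\mathbb{R}^N$ and let $P:\mathbb{R}^N\to\mathbb{R}^N$ be a discrete-time nonlinear Markov chain satisfying: (1) monotonicity: for all $u,v\in\mathbb{R}^N$, $u\ge v$ implies $Pu\ge Pv$; (2) strict monotonicity of corresponding components: for all $u,v\in\mathbb{R}^N$ and every component $x\in\{1,\dots,N\}$, if $u\ge v$ and $u(x)>v(x)$, then $Pu(x)>Pv(x)$; (4) constant additivity: $P(u+C\cdot\overrightarrow{1})=Pu+C\cdot\overrightarrow{1}$ for all $u\in\mathbb{R}^N$ and all constants $C\in\mathbb{R}$; (8) accumulation point at infinity: there exists a component $x_0\in\{1,\dots,N\}$ such that $f_n:=P^nf-P^nf(x_0)\cdot\overrightarrow{1}$ has a finite accumulation point $g\in\mathbb{R}^N$. Then $f_n\to g$ as $n\to\infty$. Moreover, if $P$ also satisfies (6) connectedness: there exists $n_0\in\mathbb{N}_+$ such that for every component $x$ and all $u,v\in\mathbb{R}^N$ with $u\ge v$ and $u(x)>v(x)$, one has $P^{n_0}u>P^{n_0}v$ (strict inequality in every component), then the convergence limit is unique. That is, for any other sequence $\tilde f_n:=P^n\tilde f-P^n\tilde f(\tilde x)\cdot\overrightarrow{1}$ with $\tilde f\in\mathbb{R}^N$ and $\tilde x\in\{1,\dots,N\}$ (possibly different from $f$ and $x_0$), if it has a finite accumulation point $\tilde g$, then $\lim_{n\to\infty}\tilde f_n=\tilde g=g=\lim_{n\to\infty}f_n$.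
   Context: Inequalities between vectors of $\mathbb{R}^N$ are componentwise. $\overrightarrow{1}=(1,\dots,1)\in\mathbb{R}^N$, $\|u\|_\infty=\max_x|u(x)|$, and $P^n$ is the $n$-fold iterate of $P$. A vector $g\in\mathbb{R}^N$ is a finite accumulation point of a sequence $(h_n)$ in $\mathbb{R}^N$ if for every $n\in\mathbb{N}_+$ and every $\epsilon>0$ there is $k>n$ with $\|h_k-g\|_\infty<\epsilon$. A discrete-time nonlinear Markov chain on $\mathbb{R}^N$ is a map $P:\mathbb{R}^N\to\mathbb{R}^N$ satisfying monotonicity (1) and non-expansion, $\|Pu-Pv\|_\infty\le\|u-v\|_\infty$ for all $u,v\in\mathbb{R}^N$; non-expansion follows from (1) and (4).
   Formalization: The equality g̃ = g is false in general when x̃ ≠ x_0 (g vanishes at x_0, g̃ at x̃); it is replaced by g̃ = g − g(x̃)·1 for every x̃, with g̃ = g when x̃ = x_0. *)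

(* Defs.v *)
From mathcomp Require Import all_boot all_order all_algebra.
From mathcomp Require Import all_classical all_reals all_analysis.
Set Implicit Arguments.
Unset Strict Implicit.
Unset Printing Implicit Defensive.
Import Order.TTheory GRing.Theory Num.Theory.
Import numFieldNormedType.Exports.
Local Open Scope classical_set_scope.
Local Open Scope ring_scope.

(* Vectors of R^N are row vectors 'rV[R]_N, whose canonical norm `|u| is the
   sup norm max_x |u 0 x|, and const_mx c is the vector c * (1, ..., 1). *)

Definition vge (R : realType) (N : nat) (u v : 'rV[R]_N) : Prop :=
  forall x : 'I_N, v 0 x <= u 0 x.

Definition vgt (R : realType) (N : nat) (u v : 'rV[R]_N) : Prop :=
  forall x : 'I_N, v 0 x < u 0 x.

Definition monotone_map (R : realType) (N : nat)
    (P : 'rV[R]_N -> 'rV[R]_N) : Prop :=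
  forall u v : 'rV[R]_N, vge u v -> vge (P u) (P v).

Definition nonexpansive (R : realType) (N : nat)
    (P : 'rV[R]_N -> 'rV[R]_N) : Prop :=
  forall u v : 'rV[R]_N, `|P u - P v| <= `|u - v|.

Definition nonlinear_markov_chain (R : realType) (N : nat)
    (P : 'rV[R]_N -> 'rV[R]_N) : Prop :=
  monotone_map P /\ nonexpansive P.

Definition strictly_monotone_components (R : realType) (N : nat)
    (P : 'rV[R]_N -> 'rV[R]_N) : Prop :=
  forall (u v : 'rV[R]_N) (x : 'I_N),
    vge u v -> v 0 x < u 0 x -> P v 0 x < P u 0 x.

Definition constant_additive (R : realType) (N : nat)
    (P : 'rV[R]_N -> 'rV[R]_N) : Prop :=
  forall (u : 'rV[R]_N) (C : R), P (u + const_mx C) = P u + const_mx C.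

Definition connected_chain (R : realType) (N : nat)
    (P : 'rV[R]_N -> 'rV[R]_N) : Prop :=
  exists2 n0 : nat, (0 < n0)%N &
    forall (x : 'I_N) (u v : 'rV[R]_N),
      vge u v -> v 0 x < u 0 x -> vgt (iter n0 P u) (iter n0 P v).

Definition normalized_iterates (R : realType) (N : nat)
    (P : 'rV[R]_N -> 'rV[R]_N) (f : 'rV[R]_N) (x0 : 'I_N) (n : nat) :
    'rV[R]_N :=
  iter n P f - const_mx (iter n P f 0 x0).

Definition finite_accumulation_point (R : realType) (N : nat)
    (h : nat -> 'rV[R]_N) (g : 'rV[R]_N) : Prop :=
  forall (n : nat) (e : R), (0 < n)%N -> 0 < e ->
    exists2 k : nat, (n < k)%N & `|h k - g| < e.

(* Main.v *)
(* An accumulation point g is recurrent modulo constants: by non-expansion P^m g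
   is close to g + c for arbitrarily large m. Let l and l' be the maximal and the
   minimal component of P g - g. Strict monotonicity and recurrence give
   components a and b with P^m g (a) = g(a) + m l and P^m g (b) = g(b) + m l' for
   all m, and recurrence then forces l = l', so P g = g + l. Non-expansion turns
   the accumulation into convergence. Under connectedness two vectors shifted by
   constants by P differ by a constant, by comparison at a maximum of their
   difference. *)
Require Import Defs.
From mathcomp Require Import all_boot all_order all_algebra.
From mathcomp Require Import all_classical all_reals all_analysis.
From mathcomp Require Import lra zify.
Import Order.TTheory GRing.Theory Num.Theory.
Import numFieldNormedType.Exports.
Local Open Scope classical_set_scope.
Local Open Scope ring_scope.

(** * Sup norm and componentwise maxima *)

Lemma norm_rV_le (R : realType) (N : nat) (u : 'rV[R]_N) (e : R) :
  0 <= e -> (`|u| <= e) <-> (forall x, `|u 0 x| <= e).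
Proof.
move=> e0; rewrite /Num.norm /= mx_normrE; split=> [ue x|ue].
  by apply: le_trans ue; apply: (le_bigmax _ (fun ij => `|u ij.1 ij.2|) (0, x)).
by apply: bigmax_le => // -[i x] _; rewrite (ord1 i); exact: ue.
Qed.

Lemma norm_rV_entry (R : realType) (N : nat) (u : 'rV[R]_N) x : `|u 0 x| <= `|u|.
Proof. exact: (norm_rV_le _ _ u _ (normr_ge0 u)).1. Qed.

Lemma const_mxN (R : realType) (N : nat) (c : R) :
  const_mx (- c) = - const_mx c :> 'rV[R]_N.
Proof. by apply/rowP => x; rewrite !mxE. Qed.

Lemma exists_maximizer (R : realType) (N : nat) (F : 'I_N -> R) (x0 : 'I_N) :
  exists x, forall y, F y <= F x.
Proof.
have [x _ xmax] := @Order.TotalTheory.arg_maxP _ _ _ x0 xpredT F isT.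
by exists x => y; exact: xmax.
Qed.

(** * Iterates and recurrence modulo constants *)

Definition recurrent {R : realType} {N : nat} (P : 'rV[R]_N -> 'rV[R]_N)
    (g : 'rV[R]_N) : Prop :=
  forall (M : nat) (e : R), 0 < e ->
    exists m c, (M < m)%N /\ `|iter m P g - (g + const_mx c)| < e.

Lemma iter_const_add (R : realType) (N : nat) (P : 'rV[R]_N -> 'rV[R]_N) n u C :
  constant_additive P -> iter n P (u + const_mx C) = iter n P u + const_mx C.
Proof. by move=> hC; elim: n => //= n ->; rewrite hC. Qed.

Lemma iter_nonexpansive (R : realType) (N : nat) (P : 'rV[R]_N -> 'rV[R]_N) n :
  nonexpansive P -> nonexpansive (iter n P).
Proof.
by move=> hP u v; elim: n => //= n IH; apply: le_trans (hP _ _) IH.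
Qed.

Lemma iter_monotone (R : realType) (N : nat) (P : 'rV[R]_N -> 'rV[R]_N) n :
  monotone_map P -> monotone_map (iter n P).
Proof. by move=> hP u v uv; elim: n => //= n IH; exact: hP. Qed.

Lemma iter_additive_eigenvector (R : realType) (N : nat)
    (P : 'rV[R]_N -> 'rV[R]_N) g l n : constant_additive P ->
  P g = g + const_mx l -> iter n P g = g + const_mx (n%:R * l).
Proof.
move=> hC Pg; elim: n => [|n IH] /=; first by apply/rowP => x; rewrite !mxE; lra.
by rewrite IH hC Pg; apply/rowP => x; rewrite !mxE; lra.
Qed.

Lemma iter_normalized (R : realType) (N : nat) (P : 'rV[R]_N -> 'rV[R]_N)
    f x0 k m : constant_additive P ->
  iter m P (normalized_iterates P f x0 k) =
  iter (m + k) P f - const_mx (iter k P f 0 x0).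
Proof.
move=> hC; rewrite /normalized_iterates -const_mxN iter_const_add //.
by rewrite iterD const_mxN.
Qed.

(** Take times [k1 < k2] at which the normalized iterates are close to [g]. Applying [k2 - k1] steps
    to the first gives the second up to a constant, and non-expansion carries the closeness along;
    [c] is the change of the normalizing constant. *)
Lemma accumulation_recurrent (R : realType) (N : nat) (P : 'rV[R]_N -> 'rV[R]_N)
    f x0 g : nonexpansive P -> constant_additive P ->
  finite_accumulation_point (normalized_iterates P f x0) g -> recurrent P g.
Proof.
move=> hN hC hacc M e e0.
have e2 : 0 < e / 2 by lra.
have [k1 _ h1] := hacc 1%N _ isT e2.
have [k2 k12 h2] := hacc (k1 + M).+1 _ isT e2.
exists (k2 - k1)%N, (iter k2 P f 0 x0 - iter k1 P f 0 x0); split; first by lia.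
have := iter_nonexpansive _ _ _ (k2 - k1)%N hN (normalized_iterates P f x0 k1) g.
rewrite iter_normalized // subnK; last by lia.
move=> h3.
rewrite (_ : _ - _ = - (iter k2 P f - const_mx (iter k1 P f 0 x0) -
    iter (k2 - k1) P g) + (normalized_iterates P f x0 k2 - g)); last first.
  by apply/rowP => x; rewrite !mxE; lra.
by apply: le_lt_trans (ler_normD _ _) _; rewrite normrN; lra.
Qed.

(** * Extremal increments of a recurrent vector *)

Lemma iter_increment_le (R : realType) (N : nat) (P : 'rV[R]_N -> 'rV[R]_N) u l m :
  monotone_map P -> constant_additive P ->
  (forall x, P u 0 x <= u 0 x + l) ->
  forall x, iter m.+1 P u 0 x <= iter m P u 0 x + l.
Proof.
move=> hM hC ul x.
have vu : vge (u + const_mx l) (P u) by move=> y; rewrite !mxE.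
have := iter_monotone _ _ _ m hM _ _ vu x.
by rewrite iter_const_add // -iterSr !mxE.
Qed.

(* The set of components whose increment at time m equals the maximum l is
   nonincreasing in m by strict monotonicity. If it became empty, the increments
   would stay below some l' < l, which contradicts recurrence. *)
Lemma max_increment_persists (R : realType) (N : nat)
    (P : 'rV[R]_N -> 'rV[R]_N) g l x0 :
  monotone_map P -> nonexpansive P -> strictly_monotone_components P ->
  constant_additive P -> recurrent P g ->
  (forall x, P g 0 x <= g 0 x + l) -> P g 0 x0 = g 0 x0 + l ->
  exists x, forall m, iter m P g 0 x = g 0 x + m%:R * l.
Proof.
move=> hM hN hS hC hR gl gx0.
suff [x hx] : exists x, forall m, iter m.+1 P g 0 x = iter m P g 0 x + l.
  exists x; elim=> [|m IH]; first by rewrite /=; lra.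
  by rewrite hx IH; lra.
apply: contrapT => /forallNP hne.
have {hne} hlt x : exists m, iter m.+1 P g 0 x < iter m P g 0 x + l.
  have /existsNP[m hm] := hne x; exists m.
  by rewrite lt_neqAle iter_increment_le // andbT; apply/eqP.
have [m hm] := choice hlt.
have persist x k : (m x <= k)%N -> iter k.+1 P g 0 x < iter k P g 0 x + l.
  elim: k => [|k IH]; first by rewrite leqn0 => /eqP m0; have := hm x; rewrite m0.
  rewrite leq_eqVlt => /orP[/eqP <- //|/IH hk].
  (* A strict gap at [x] below the upper bound [iter k P g + const_mx l] survives one more
     application of [P]. *)
  have := hS (iter k P g + const_mx l) (iter k.+1 P g) x.
  rewrite hC !mxE; apply=> // y; rewrite mxE mxE.
  exact: iter_increment_le.
(* By time [M] every component has a strict gap, so the largest increment [l'] at that time is below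
   [l] and bounds all later increments. *)
pose M := (\max_x m x)%N; pose h := iter M P g.
have [y hy] := exists_maximizer _ _ (fun x => P h 0 x - h 0 x) x0.
pose l' := P h 0 y - h 0 y.
have l'l : l' < l.
  have := persist y M (leq_bigmax y); rewrite /l' /h /=; lra.
have hl' x : P h 0 x <= h 0 x + l' by have := hy x; rewrite /l'; lra.
(* At a recurrence time [k > M], both [iter k P g] and its image are within this distance of [g + c]
   and [P g + c]. The increment at [x0] then exceeds [l - (l - l') = l'], a contradiction. *)
have e0 : 0 < (l - l') / 2 by lra.
have [k [c [Mk hk]]] := hR M _ e0.
have := le_lt_trans (hN _ _) hk; rewrite hC => hk'.
have a1 := le_lt_trans (norm_rV_entry _ _ _ x0) hk.
have a2 := le_lt_trans (norm_rV_entry _ _ _ x0) hk'.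
have := iter_increment_le _ _ _ _ _ (k - M)%N hM hC hl' x0.
rewrite /h -!iterD addSn subnK ?(ltnW Mk) //=.
move: a1 a2; rewrite !mxE gx0 !ltr_norml => /andP[a1 a2] /andP[a3 a4]; lra.
Qed.

Lemma iter_opp_conj (R : realType) (N : nat) (P : 'rV[R]_N -> 'rV[R]_N) m u :
  iter m (fun v => - P (- v)) (- u) = - iter m P u.
Proof. by elim: m => //= m ->; rewrite opprK. Qed.

(* The map u |-> - P (- u) inherits all the hypotheses on P. *)
Lemma min_increment_persists (R : realType) (N : nat)
    (P : 'rV[R]_N -> 'rV[R]_N) g l x0 :
  monotone_map P -> nonexpansive P -> strictly_monotone_components P ->
  constant_additive P -> recurrent P g ->
  (forall x, g 0 x + l <= P g 0 x) -> P g 0 x0 = g 0 x0 + l ->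
  exists x, forall m, iter m P g 0 x = g 0 x + m%:R * l.
Proof.
move=> hM hN hS hC hR gl gx0.
have [x hx] : exists x, forall m,
    iter m (fun v => - P (- v)) (- g) 0 x = (- g) 0 x + m%:R * (- l).
  apply: (@max_increment_persists _ _ _ _ _ x0).
  - move=> u v uv y; rewrite !mxE lerN2; apply: hM => z.
    by rewrite !mxE lerN2; exact: uv.
  - by move=> u v; rewrite -opprD normrN (le_trans (hN _ _))// -opprD normrN.
  - move=> u v y uv uvy; rewrite !mxE ltrN2; apply: hS.
      by move=> z; rewrite !mxE lerN2; exact: uv.
    by rewrite !mxE ltrN2.
  - by move=> u C; rewrite opprD -const_mxN hC const_mxN opprB addrC.
  - move=> M e e0; have [m [c [Mm hm]]] := hR M e e0.
    exists m, (- c); split=> //; rewrite iter_opp_conj const_mxN -opprD -opprD.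
    by rewrite normrN.
  - by move=> y; rewrite opprK !mxE; have := gl y; lra.
  - by rewrite opprK !mxE gx0; lra.
exists x => m; have := hx m; rewrite iter_opp_conj !mxE; lra.
Qed.

Lemma recurrent_additive_eigenvector (R : realType) (N : nat)
    (P : 'rV[R]_N -> 'rV[R]_N) g (x0 : 'I_N) :
  monotone_map P -> nonexpansive P -> strictly_monotone_components P ->
  constant_additive P -> recurrent P g ->
  exists l, P g = g + const_mx l.
Proof.
move=> hM hN hS hC hR.
have [y hy] := exists_maximizer _ _ (fun x => P g 0 x - g 0 x) x0.
have [z hz] := exists_maximizer _ _ (fun x => - (P g 0 x - g 0 x)) x0.
set l := P g 0 y - g 0 y in hy; set l' := P g 0 z - g 0 z in hz.
have [a ha] : exists x, forall m, iter m P g 0 x = g 0 x + m%:R * l.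
  apply: (@max_increment_persists _ _ _ _ _ y) => //; last by rewrite /l; lra.
  by move=> x; have := hy x; lra.
have [b hb] : exists x, forall m, iter m P g 0 x = g 0 x + m%:R * l'.
  apply: (@min_increment_persists _ _ _ _ _ z) => //; last by rewrite /l'; lra.
  by move=> x; have := hz x; lra.
(* Closeness to [g + c] forces both [m l] and [m l'] within [(l - l') / 2] of [c], hence
   [m (l - l') < l - l'], impossible for [m >= 1]. *)
have ll' : l <= l'.
  rewrite leNgt; apply/negP => l'l.
  have e0 : 0 < (l - l') / 2 by lra.
  have [m [c [m0 hm]]] := hR 0%N _ e0.
  have := le_lt_trans (norm_rV_entry _ _ _ a) hm.
  have := le_lt_trans (norm_rV_entry _ _ _ b) hm.
  rewrite !mxE ha hb !ltr_norml => /andP[h1 h2] /andP[h3 h4].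
  have m1 : 1 <= m%:R :> R by rewrite ler1n.
  have : 1 * (l - l') <= m%:R * (l - l') by rewrite ler_wpM2r //; lra.
  lra.
exists l; apply/rowP => x; rewrite !mxE.
by have := hy x; have := hz x; lra.
Qed.

(** * Convergence to the accumulation point *)

Lemma accumulation_normalized (R : realType) (N : nat)
    (P : 'rV[R]_N -> 'rV[R]_N) f x0 g :
  finite_accumulation_point (normalized_iterates P f x0) g -> g 0 x0 = 0.
Proof.
move=> hacc; apply/eqP; rewrite -normr_le0 leNgt; apply/negP => g0.
have [k _ hk] := hacc 1%N _ isT g0.
have := le_lt_trans (norm_rV_entry _ _ _ x0) hk.
by rewrite !mxE subrr sub0r normrN ltxx.
Qed.

(** The orbit of [g] moves only by constants, so closeness to [g] modulo constants, once reached,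
    persists. The unknown constant is controlled at [x0], where both vectors vanish; this costs the
    factor 2 in [e / 2]. *)
Lemma normalized_iterates_cvg (R : realType) (N : nat)
    (P : 'rV[R]_N -> 'rV[R]_N) f x0 g l :
  nonexpansive P -> constant_additive P -> P g = g + const_mx l ->
  finite_accumulation_point (normalized_iterates P f x0) g ->
  normalized_iterates P f x0 n @[n --> \oo] --> g.
Proof.
move=> hN hC Pg hacc.
have gx0 := accumulation_normalized _ _ _ _ _ _ hacc.
apply/cvgrPdist_le => e e0.
have e2 : 0 < e / 2 by lra.
have [k _ hk] := hacc 1%N _ isT e2.
exists k => // n /= kn.
have hm := le_lt_trans (iter_nonexpansive _ _ _ (n - k)%N hN _ _) hk.
rewrite iter_normalized // subnK // (iter_additive_eigenvector _ _ _ _ _ _ hC Pg) in hm.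
have h0 := le_lt_trans (norm_rV_entry _ _ _ x0) hm.
apply/(norm_rV_le _ _ _ _ (ltW e0)) => x.
have := le_lt_trans (norm_rV_entry _ _ _ x) hm.
move: h0; rewrite /normalized_iterates !mxE gx0 ler_norml !ltr_norml.
by move=> /andP[h1 h2] /andP[h3 h4]; lra.
Qed.

(** * Comparison of additive eigenvectors *)

Lemma additive_eigenvalue_le (R : realType) (N : nat)
    (P : 'rV[R]_N -> 'rV[R]_N) g g1 l l1 (x0 : 'I_N) :
  monotone_map P -> constant_additive P ->
  P g = g + const_mx l -> P g1 = g1 + const_mx l1 -> l1 <= l.
Proof.
move=> hM hC Pg Pg1.
have [y hy] := exists_maximizer _ _ (fun x => g1 0 x - g 0 x) x0.
(* Raised by the maximum of [g1 - g], the vector [g] touches [g1] from above at [y]; reading the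
   order of the images at [y] leaves [l1 <= l]. *)
have : vge (g + const_mx (g1 0 y - g 0 y)) g1.
  by move=> x; rewrite !mxE; have := hy x; lra.
by move=> /hM/(_ y); rewrite hC Pg Pg1 !mxE; lra.
Qed.

Lemma additive_eigenvector_unique (R : realType) (N : nat)
    (P : 'rV[R]_N -> 'rV[R]_N) g g1 l l1 (x0 : 'I_N) :
  monotone_map P -> constant_additive P -> connected_chain P ->
  P g = g + const_mx l -> P g1 = g1 + const_mx l1 ->
  exists c, g1 = g + const_mx c.
Proof.
move=> hM hC [n0 _ hconn] Pg Pg1.
have ll1 : l1 = l.
  by apply/le_anti/andP; split; apply: additive_eigenvalue_le x0 hM hC _ _; eassumption.
have [y hy] := exists_maximizer _ _ (fun x => g1 0 x - g 0 x) x0.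
pose c := g1 0 y - g 0 y; exists c.
have gg1 : vge (g + const_mx c) g1.
  by move=> x; rewrite !mxE /c; have := hy x; lra.
apply/rowP => x; apply/eqP; rewrite eq_le gg1 /= leNgt; apply/negP => gx.
(* Connectedness would separate the two vectors at the contact point [y] after [n0] steps, but both
   are shifted by the same [n0 l] and still agree there. *)
have := hconn x _ _ gg1 gx y.
rewrite iter_const_add // !(iter_additive_eigenvector _ _ _ _ _ _ hC Pg).
by rewrite (iter_additive_eigenvector _ _ _ _ _ _ hC Pg1) ll1 !mxE /c; lra.
Qed.

(* Two normalizing components x0 and x1 can only give limits that agree up to
   an additive constant, since g vanishes at x0 and g1 at x1; the constant is
   fixed by g1 0 x1 = 0, and for x1 = x0 the limits are equal. *)
Theorem theorem2 (R : realType) (N : nat) (P : 'rV[R]_N -> 'rV[R]_N)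
    (f : 'rV[R]_N)
    (hP : nonlinear_markov_chain P)
    (hstrict : strictly_monotone_components P)
    (hconst : constant_additive P)
    (x0 : 'I_N) (g : 'rV[R]_N)
    (hacc : finite_accumulation_point (normalized_iterates P f x0) g) :
  (normalized_iterates P f x0 n @[n --> \oo] --> g) /\
  (connected_chain P ->
   forall (f1 : 'rV[R]_N) (x1 : 'I_N) (g1 : 'rV[R]_N),
     finite_accumulation_point (normalized_iterates P f1 x1) g1 ->
     [/\ normalized_iterates P f1 x1 n @[n --> \oo] --> g1,
         g1 = g - const_mx (g 0 x1) &
         x1 = x0 -> g1 = g]).
Proof.
have [hM hN] := hP.
have eig f' x' g' : finite_accumulation_point (normalized_iterates P f' x') g' ->
    exists l, P g' = g' + const_mx l.
  move=> /(accumulation_recurrent _ _ _ _ _ _ hN hconst).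
  exact: recurrent_additive_eigenvector.
have [l Pg] := eig _ _ _ hacc.
split; first exact: normalized_iterates_cvg Pg hacc.
move=> hconn f1 x1 g1 hacc1.
have [l1 Pg1] := eig _ _ _ hacc1.
have [c g1E] :=
  additive_eigenvector_unique _ _ _ _ _ _ _ x0 hM hconst hconn Pg Pg1.
have gx0 := accumulation_normalized _ _ _ _ _ _ hacc.
have g1x1 := accumulation_normalized _ _ _ _ _ _ hacc1.
have g1E' : g1 = g - const_mx (g 0 x1).
  rewrite g1E; apply/rowP => x; move: g1x1; rewrite g1E !mxE; lra.
split=> //; first exact: normalized_iterates_cvg Pg1 hacc1.
by move=> x10; rewrite g1E' x10 gx0; apply/rowP => x; rewrite !mxE subr0.
Qed.
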